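(* For every positive integer $n$, $$A_{5,3,3}(n)=B^0_{5,3,3}(n).$$
   Context: A partition of $n$ is written $b_1+\cdots+b_s=n$ with positive integer parts $b_1\ge b_2\ge\cdots\ge b_s$. For a positive integer $j$, $f_j$ denotes the number of appearances of $j$ as a part of the partition. For odd $\lambda$, $A_{\lambda,k,a}(n)$ is the number of partitions of $n$ such that: no part $\not\equiv 0 \pmod{\frac{\lambda+1}{2}}$ is repeated; no part is $\equiv \lambda+1 \pmod{2\lambda+2}$; and no part is $\equiv 0,\pm(2a-\lambda)\frac{\lambda+1}{2} \pmod{(2k-\lambda+1)(\lambda+1)}$. Thus for $\lambda=5$, $k=a=3$: $A_{5,3,3}(n)$ is the number of partitions of $n$ in which no part $\not\equiv0\pmod 3$ is repeated, no part is $\equiv 6\pmod{12}$, and no part is $\equiv 0,\pm3\pmod{12}$. $B_{\lambda,k,a}(n)$ is the number of partitions $b_1+\cdots+b_s$ of $n$ (with $b_i\ge b_{i+1}$) such that: no part $\not\equiv0\pmod{\lambda+1}$ is repeated; $b_i-b_{i+k-1}\ge\lambda+1$ whenever $1\le i$ and $i+k-1\le s$, with strict inequality if $b_i$ is a multiple of $\lambda+1$; $\sum_{i=j}^{\lambda-j+1}f_i\le a-j$ for $1\le j\le\frac{\lambda+1}{2}$; and $f_1+\cdots+f_{\lambda+1}\le a-1$. Thus $B_{5,3,3}(n)$ is the number of partitions of $n$ in which no part $\not\equiv 0\pmod 6$ is repeated; $b_i-b_{i+2}\ge 6$ (for $1\le i\le s-2$), with strict inequality if $6\mid b_i$; $f_1+f_2+f_3+f_4+f_5\le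 2$, $f_2+f_3+f_4\le 1$, $f_3\le 0$; and $f_1+\cdots+f_6\le 2$. $B^0_{5,3,3}(n)$ is the number of partitions of $n$ enumerated by $B_{5,3,3}(n)$ that satisfy in addition: $f_{6j+3}=0$ for all $j\ge0$; $f_{6j+2}+f_{6j+4}\le1$ for all $j\ge0$; $f_{6j+5}+f_{6j+7}\le1$ for all $j\ge0$; $f_{6j-1}+f_{6j}+f_{6j+6}+f_{6j+7}\le3$ for all $j\ge1$. *)

(* Defs.v *)
From HB Require Import structures.
From mathcomp Require Import all_boot all_order all_algebra.
From mathcomp Require Import boolp.

Set Implicit Arguments.
Unset Strict Implicit.
Unset Printing Implicit Defensive.

Definition is_partition (n : nat) (b : seq nat) : bool :=
  [&& sorted geq b, all (leq 1) b & sumn b == n].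

(* f_j *)
Definition mult (b : seq nat) (j : nat) : nat := count_mem j b.

(* A partition of n has at most n parts, each at most n, so [n.-bseq 'I_n.+1]
   is a finite type in which every partition of n occurs exactly once;
   see num_partitionsE. *)
Definition num_partitions (n : nat) (P : seq nat -> Prop) : nat :=
  #|[set p : n.-bseq 'I_n.+1 |
      is_partition n [seq val i | i <- p] && `[< P [seq val i | i <- p] >] ]|.

(* Here and in B_cond, lambda is meant to be odd, so that h = (lambda + 1) / 2 is
   exact.  The congruences are over int, since 2a - lambda and 2k - lambda + 1 may be
   negative. *)
Definition A_cond (lambda k a : nat) (b : seq nat) : Prop :=
  let h := lambda.+1./2 in
  let c := (((2 * a)%:Z - lambda%:Z) * h%:Z)%R in
  let m := (((2 * k)%:Z - lambda%:Z + 1) * (lambda.+1)%:Z)%R in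
  [/\ forall x, ~~ (h %| x) -> mult b x <= 1,
      forall x, x \in b -> x != lambda.+1 %[mod 2 * lambda + 2]
    & forall x : nat, x \in b ->
        [/\ (x%:Z != 0 %[mod m])%Z,
            (x%:Z != c %[mod m])%Z
          & (x%:Z != (- c)%R %[mod m])%Z]].

(* The parts are indexed from 0: [nth 0 b i] is b_{i+1}.  The inequalities are
   rearranged so that no truncated subtraction occurs, except in [k.-1] and in
   the upper summation bound, where k >= 1 and j <= lambda. *)
Definition B_cond (lambda k a : nat) (b : seq nat) : Prop :=
  [/\ forall x, ~~ (lambda.+1 %| x) -> mult b x <= 1,
      forall i, i + k.-1 < size b ->
        nth 0 b (i + k.-1) + lambda.+1 <= nth 0 b i,
      forall i, i + k.-1 < size b -> lambda.+1 %| nth 0 b i ->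
        nth 0 b (i + k.-1) + lambda.+1 < nth 0 b i,
      forall j, 1 <= j <= lambda.+1./2 ->
        \sum_(j <= i < (lambda - j + 1).+1) mult b i + j <= a
    & \sum_(1 <= i < lambda.+2) mult b i + 1 <= a].

Definition A (lambda k a n : nat) : nat :=
  num_partitions n (A_cond lambda k a).

Definition B (lambda k a n : nat) : nat :=
  num_partitions n (B_cond lambda k a).

Definition B0_cond (b : seq nat) : Prop :=
  let f := mult b in
  [/\ forall j, f (6 * j + 3) = 0,
      forall j, f (6 * j + 2) + f (6 * j + 4) <= 1,
      forall j, f (6 * j + 5) + f (6 * j + 7) <= 1
    & forall j, 1 <= j ->
        f (6 * j - 1) + f (6 * j) + f (6 * j + 6) + f (6 * j + 7) <= 3].

Definition B0_533 (n : nat) : nat :=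
  num_partitions n (fun b => B_cond 5 3 3 b /\ B0_cond b).

Lemma is_partition_bseq (n : nat) (b : seq nat) : is_partition n b ->
  exists p : n.-bseq 'I_n.+1, [seq val i | i <- p] = b.
Proof.
case/and3P=> _ pos /eqP <- {n}.
have szb : size b <= sumn b.
  elim: b pos => //= x b IH /andP[x0 /IH le_b].
  by rewrite -add1n leq_add.
have leb x : x \in b -> x < (sumn b).+1.
  rewrite ltnS; elim: b {pos szb} => //= y b IH.
  rewrite inE => /predU1P[->|/IH]; first exact: leq_addr.
  by move=> h; apply: leq_trans h (leq_addl _ _).
have sz : size [seq inord x : 'I_(sumn b).+1 | x <- b] <= sumn b.
  by rewrite size_map.
exists (Bseq sz); rewrite /= -map_comp -[RHS]map_id.
by apply/eq_in_map => x /leb ltx /=; rewrite inordK.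
Qed.

Lemma num_partitionsE (n : nat) (P : seq nat -> Prop) (s : seq (seq nat)) :
  uniq s -> (forall b, b \in s <-> is_partition n b /\ P b) ->
  num_partitions n P = size s.
Proof.
move=> us sP; rewrite /num_partitions.
pose g (p : n.-bseq 'I_n.+1) := [seq val i | i <- p].
have injg : injective g by move=> p q /(inj_map val_inj)/val_inj.
rewrite cardE -(size_map g); apply/perm_size/uniq_perm => //.
  by rewrite map_inj_uniq ?enum_uniq.
move=> b; apply/mapP/idP.
  by case=> p; rewrite mem_enum inE => /andP[h1 /asboolP h2] ->; apply/sP.
case/sP=> hb Pb; have [p pb] := is_partition_bseq hb.
by exists p => //; rewrite mem_enum inE pb hb; apply/asboolP.
Qed.

(* Main.v *)
Require Import Defs.
From mathcomp Require Import all_boot all_algebra.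
From mathcomp Require Import ring zify.

Set Implicit Arguments.
Unset Strict Implicit.
Unset Printing Implicit Defensive.

(** The congruence conditions on the left exclude all multiples of 3, so that side
    counts the partitions of n into distinct parts prime to 3, whose generating
    function is the product over i >= 0 of
    (1 + q^(6i+1)) (1 + q^(6i+2)) (1 + q^(6i+4)) (1 + q^(6i+5)).
    The theorem says that the partitions counted on the right have the same
    generating function.

    Give a right-hand partition the weight y^d q^n, where n is its size and d its
    number of parts, a multiple of 6 being counted twice (it stands for a pair of
    parts, 1 + 5 or 2 + 4 modulo 6).  Let P_m(y) be the generating function of
    those with parts at most m.  The heart of the proof is the finite identity
      P_(6N+6)(y) = (1 + y q) (1 + y q^2) (1 + y q^4) (1 + y q^5) P_(6N-1)(y q^6)
    (cut6_factor).  Iterating it at y = 1, q^6, q^12 and so on splits off the factors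
    of the product one after the other, and because at y = q^(6r) a nonempty partition
    contributes only to powers of q beyond q^(6r), finitely many steps determine each
    coefficient (coef_blocks).

    For the finite identity, the constraints on a right-hand partition are first
    rewritten as a local rule: p may be placed on top of b_1 >= b_2 >= b_3 >= ...
    exactly when p, b_1, b_2, b_3 satisfy an explicit condition (fits; the
    equivalence is B_cond_admissible).  Removing the largest part then gives
    recurrences between the generating functions of the families (capped m k) of
    partitions with first part at most m and second part at most k.  Four of these
    families per block of six consecutive integers are enough to close the
    recurrence (next_block, genfun_blocks).  The identity is one component of an
    identity between vectors of length four (blocks_factor), which is proved by
    induction on N: the map insert_factor intertwines the recurrence at y q^6 with
    the recurrence at y (insert_factor_next), a polynomial identity. *)

(** * A local description of the partitions counted by B0 *)

(** The condition for adding p on top of a partition with first three parts b1, b2,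
    b3, where a missing part is 0.  The clause on b1 + 2 forbids both the pairs
    6j+2, 6j+4 and the pairs 6j+5, 6j+7.  Given the other clauses, the only way to
    violate the bound by 3 on four multiplicities is the chain 6j-1, 6j, 6j+6, 6j+7,
    which is excluded by the last clause. *)
Definition fits (p b1 b2 b3 : nat) : bool :=
  [&& 0 < p, p %% 6 != 3, b1 <= p, (b1 == p) ==> (p %% 6 == 0),
      (b2 == 0) || (b2 + 6 + (p %% 6 == 0) <= p),
      (b1 + 2 == p) ==> (p %% 3 != 1)
    & ~~ [&& p %% 6 == 1, b1 + 1 == p, b2 + 7 == p & b3 + 8 == p]].

Fixpoint admissible (b : seq nat) : bool :=
  if b is p :: b' then
    fits p (nth 0 b' 0) (nth 0 b' 1) (nth 0 b' 2) && admissible b'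
  else true.

Lemma admissible_sorted b : admissible b -> sorted geq b && all (leq 1) b.
Proof.
elim: b => //= p b IH /andP[/and5P[-> _ bp _ _] /IH /andP[sb ->]]; rewrite andbT.
by case: b sb bp {IH} => //= x b -> ->.
Qed.

Lemma admissible_tail p b : admissible (p :: b) -> admissible b.
Proof. by case/andP. Qed.

Lemma admissible_nth b i : admissible b -> 0 < nth 0 b i ->
  fits (nth 0 b i) (nth 0 b i.+1) (nth 0 b i.+2) (nth 0 b i.+3).
Proof.
elim: b i => [|p b IH] [|i] //=; last by case/andP=> _ /IH; apply.
by case/andP.
Qed.

Lemma nth_antitone b i : admissible b -> nth 0 b i.+1 <= nth 0 b i.
Proof.
move=> Ab; case: (posnP (nth 0 b i)) => [b0|/(admissible_nth Ab)/and5P[] //].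
suff sz : size b <= i by rewrite !nth_default // (leq_trans sz).
case: (leqP (size b) i) => // lt; have /andP[_ /allP pos] := admissible_sorted Ab.
by have := pos _ (mem_nth 0 lt); rewrite b0.
Qed.

Lemma mult_sorted_gt b v : sorted geq b -> nth 0 b 0 < v -> mult b v = 0.
Proof.
move=> sb xv; apply/count_memPn; case: b sb xv => // x b /= pb xv; apply/negP.
have tr : transitive geq by move=> y z w zy yw; exact: leq_trans yw zy.
rewrite inE => /predU1P[vx|vb]; first by rewrite vx ltnn in xv.
by have /allP/(_ v vb) := order_path_min tr pb; rewrite /= leqNgt xv.
Qed.

Lemma mult_pos b i : 0 < nth 0 b i -> 0 < mult b (nth 0 b i).
Proof.
move=> pos; rewrite /mult -has_count has_pred1 mem_nth //.
by case: (leqP (size b) i) => // /(nth_default 0) b0; rewrite b0 in pos.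
Qed.

(** Every two places the parts drop by at least 6, so the fourth part after p is at
    least 12 below p. *)
Lemma mult_near_top p b v : admissible (p :: b) -> 0 < v -> p <= v + 8 ->
  mult b v = (nth 0 b 0 == v) + (nth 0 b 1 == v) + (nth 0 b 2 == v).
Proof.
move=> Apb v0 pv.
have Ab := admissible_tail Apb.
have v3 : nth 0 b 3 < v.
  have h1 : (nth 0 b 1 == 0) || (nth 0 b 1 + 6 <= p).
    by case/andP: Apb => /and5P[_ _ _ _ /andP[h _]] _; lia.
  have h3 : (nth 0 b 3 == 0) || (nth 0 b 3 + 6 <= nth 0 b 1).
    case: (posnP (nth 0 b 1)) => [b1|/(admissible_nth Ab)/and5P[_ _ _ _ /andP[h _]]].
      by have := nth_antitone 1 Ab; have := nth_antitone 2 Ab; lia.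
    by lia.
  by lia.
have sb : sorted geq b by case/andP: (admissible_sorted Ab).
have st : sorted geq (drop 3 b) by apply: drop_sorted.
have z : mult (drop 3 b) v = 0 by apply: mult_sorted_gt => //; rewrite nth_drop.
rewrite /mult -[in LHS](cat_take_drop 3 b) count_cat.
rewrite -[count _ (drop _ _)]/(mult _ v) z addn0.
have ne : (0 == v) = false by case: (v) v0.
by case: (b) => [|x [|y [|w b']]] //=; rewrite ?take0 ?ne /= ?addn0 ?addnA.
Qed.

(** What admissibility imposes on the first three parts alone, in a form that also
    holds when some of them are missing.  It isolates the arithmetic about the head
    of a partition, so that it can be given to a decision procedure. *)
Definition head_shape (x y z : nat) : bool :=
  [&& x %% 6 != 3, y %% 6 != 3, y <= x, z <= y, (y == x) ==> (x %% 6 == 0),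
      (z == 0) || (z + 6 + (x %% 6 == 0) <= x) &
      (y + 2 == x) ==> (x %% 3 != 1)].

Lemma head_shape_fits x y z t u v :
  fits x y z t -> (y == 0) ==> (z == 0) -> (y == 0) || fits y z u v ->
  head_shape x y z.
Proof.
rewrite /head_shape => /and5P[x0 -> -> -> /and3P[-> -> _]] /=; rewrite andbT.
case: y => [|y] /=; first by case: z.
by move=> _ /and5P[_ -> -> _ _].
Qed.

Lemma admissible_head b :
  admissible b -> head_shape (nth 0 b 0) (nth 0 b 1) (nth 0 b 2).
Proof.
case: b => [|x [|y b]] //= /andP[fx].
  by move=> _; exact: (head_shape_fits (u := 0) (v := 0) fx).
case/andP=> fy _.
apply: (head_shape_fits fx _ (u := nth 0 b 1) (v := nth 0 b 2)).
  by case: (y) fy.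
by apply/orP; right.
Qed.

(** The sums of multiplicities in the initial conditions concern the parts at most 6,
    and the gap condition leaves room for only two of them. *)
Lemma admissible_few_small b : admissible b ->
  mult b 1 + mult b 2 + mult b 3 + mult b 4 + mult b 5 + mult b 6 <= 2.
Proof.
move=> Ab; have: count (geq 6) b <= 2.
  elim: b Ab => //= p b IH /andP[/and5P[_ _ _ _ /andP[h _]] Ab].
  case: (leqP p 6) => [p6|_]; last exact: IH.
  rewrite ltnS (leq_trans (count_size _ _)) //.
  case: b h Ab {IH} => [|x [|y b]] // h /andP[_ /andP[/and5P[y0 _ _ _ _] _]].
  by move: h => /=; lia.
apply: leq_trans; rewrite /mult; elim: b {Ab} => //= x b; lia.
Qed.

Lemma mult_cons p b v : mult (p :: b) v = (p == v) + mult b v.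
Proof. by []. Qed.

Lemma mult_above p b v : admissible (p :: b) -> p < v -> mult b v = 0.
Proof.
move=> /andP[/and5P[_ _ bp _ _] /admissible_sorted/andP[sb _]] pv.
by apply: mult_sorted_gt => //; apply: leq_ltn_trans pv.
Qed.

Lemma mult_top p b : admissible (p :: b) -> p %% 6 != 0 -> mult b p = 0.
Proof.
move=> /andP[/and5P[_ _ bp b6 _] /admissible_sorted/andP[sb _]] p6.
apply: mult_sorted_gt => //; rewrite ltn_neqAle bp andbT.
by apply: contra p6 => /(implyP b6).
Qed.

Lemma mult_two_below p b :
  admissible (p :: b) -> p %% 3 = 1 -> 2 < p -> mult b (p - 2) = 0.
Proof.
move=> Apb p1 p2; rewrite (mult_near_top Apb); try lia.
have Ab := admissible_tail Apb.
have b12 := nth_antitone 1 Ab.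
have [/and5P[_ _ _ _ /and3P[b2p b1p2 _]] _] := andP Apb.
have {b1p2} /negbTE -> : nth 0 b 0 != p - 2 by move: b1p2; rewrite p1; clear -p2; lia.
by clear -b12 b2p p2; lia.
Qed.

(** The four-term bound of B0 once its largest part, p, has been removed.  If three
    parts lay in the set 6j-1, 6j, 6j+6, the gap conditions would force them to be
    6j+6, 6j, 6j-1, which together with p is ruled out by the last clause of fits
    when p = 6j+7 and by the gap condition when p = 6j+6. *)
Lemma admissible_chain p b j : admissible (p :: b) ->
  p = 6 * j + 6 \/ p = 6 * j + 7 -> 0 < j ->
  mult b (6 * j - 1) + mult b (6 * j) + mult b (6 * j + 6) <= 2.
Proof.
move=> Apb pE j0; rewrite !(mult_near_top Apb); try (clear -pE j0; lia).
(* S counts one part, so the sum to bound is S x1 + S x2 + S x3. *)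
pose S x := (x == 6 * j - 1) + (x == 6 * j) + (x == 6 * j + 6).
have S1 x : S x <= 1 by rewrite /S; clear -j0; lia.
have S0 x : x <> 6 * j - 1 -> x <> 6 * j -> x <> 6 * j + 6 -> S x = 0.
  by rewrite /S; clear; lia.
have Ab := admissible_tail Apb; have b21 := nth_antitone 0 Ab.
have b32 := nth_antitone 1 Ab.
have [/and5P[_ _ b1p _ /and3P[b2p _ pat]] _] := andP Apb.
have /and5P[_ _ _ _ /and3P[_ b31 _]] := admissible_head Ab.
have b32' : 0 < nth 0 b 1 -> (nth 0 b 2 == nth 0 b 1) ==> (nth 0 b 1 %% 6 == 0).
  by move=> /(admissible_nth Ab)/and5P[].
set x1 := nth 0 b 0 in b21 b31 b1p pat *.
set x2 := nth 0 b 1 in b21 b32 b32' b2p pat *.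
set x3 := nth 0 b 2 in b32 b32' b31 pat *.
suff: S x1 = 0 \/ S x2 = 0 \/ S x3 = 0.
  have -> : (x1 == 6 * j - 1) + (x2 == 6 * j - 1) + (x3 == 6 * j - 1) +
    ((x1 == 6 * j) + (x2 == 6 * j) + (x3 == 6 * j)) +
    ((x1 == 6 * j + 6) + (x2 == 6 * j + 6) + (x3 == 6 * j + 6)) =
    S x1 + S x2 + S x3 by rewrite /S; ring.
  by move: (S1 x1) (S1 x2) (S1 x3); clear; lia.
case: (ltnP x1 (6 * j + 6)) => x1j.
  case: (ltnP (6 * j) x1) => x1j'; first by left; apply: S0; clear -x1j x1j'; lia.
  by right; right; apply: S0; clear -j0 x1j' b31; lia.
case: (eqVneq x1 (6 * j + 6)) => x1E; last first.
  by left; apply: S0; clear -x1j x1E; lia.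
have {b31} x3j : x3 <= 6 * j - 1 by move: b31; rewrite x1E; clear -j0; lia.
case: (eqVneq x2 (6 * j)) => [x2E|x2j].
  right; right; apply: S0; try (clear -x3j j0; lia).
  case: pE b2p pat => -> b2p pat x3E; first by move: b2p; rewrite x2E; clear -j0; lia.
  by move: pat; rewrite x1E x2E x3E; clear -j0; lia.
case: (eqVneq x3 (6 * j - 1)) => x3E.
  right; left; apply: S0; [|exact/eqP|clear -b2p pE j0; lia].
  by move=> x2E; move: b32'; rewrite x2E x3E; clear -j0; lia.
by right; right; apply: S0; [exact/eqP| |]; clear -x3j j0; lia.
Qed.

Lemma admissible_B0 b : admissible b -> B0_cond b.
Proof.
elim: b => [|p b IH] Apb; first by split.
have Ab := admissible_tail Apb; have {IH} [e1 e2 e3 e4] := IH Ab.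
have /andP[/and5P[p0 p3 _ _ _] _] := Apb.
have top := mult_top Apb; have above v := @mult_above p b v Apb.
have below := mult_two_below Apb.
split=> j; rewrite ?mult_cons.
- by rewrite e1; clear -p3; lia.
- case: (eqVneq p (6 * j + 4)) => [E|n4].
    have := top; have := below.
    rewrite E (_ : 6 * j + 4 - 2 = 6 * j + 2); last by clear; lia.
    by clear; lia.
  case: (eqVneq p (6 * j + 2)) => [E|n2]; last by rewrite /= !add0n; apply: e2.
  by have := top; have := above (6 * j + 4); rewrite E; clear; lia.
- case: (eqVneq p (6 * j + 7)) => [E|n4].
    have := top; have := below.
    rewrite E (_ : 6 * j + 7 - 2 = 6 * j + 5); last by clear; lia.
    by clear; lia.
  case: (eqVneq p (6 * j + 5)) => [E|n2]; last by rewrite /= !add0n; apply: e3.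
  by have := top; have := above (6 * j + 7); rewrite E; clear; lia.
move=> j1.
have chain := admissible_chain Apb _ j1.
case: (eqVneq p (6 * j + 7)) => [E|n7].
  by have := chain (or_intror E); have := top; rewrite E; clear -j1; lia.
case: (eqVneq p (6 * j + 6)) => [E|n6].
  by have := chain (or_introl E); have := above (6 * j + 7); rewrite E; clear -j1; lia.
case: (eqVneq p (6 * j)) => [E|n0].
  have := above (6 * j + 7); have := above (6 * j + 6).
  have : mult b (6 * j - 1) + mult b (6 * j) <= 2.
    have [/and5P[_ _ _ _ /andP[b2p _]] _] := andP Apb; have b21 := nth_antitone 1 Ab.
    rewrite !(mult_near_top Apb) ?E; try (clear -j1; lia).
    have {b2p} b2j : nth 0 b 1 < 6 * j - 1 by move: b2p; rewrite E; clear -j1; lia.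
    have far v x : 6 * j - 1 <= v -> x <= nth 0 b 1 -> (x == v) = false.
      by clear -b2j; lia.
    rewrite !(far _ (nth 0 b 1)) ?(far _ (nth 0 b 2)) //; clear; lia.
  by rewrite E; clear -j1; lia.
case: (eqVneq p (6 * j - 1)) => [E|n1]; last by rewrite /= !add0n; apply: e4.
have := above (6 * j + 7); have := above (6 * j + 6); have := above (6 * j).
by have := top; rewrite E; clear -j1; lia.
Qed.

Lemma admissible_B b : admissible b -> B_cond 5 3 3 b.
Proof.
move=> Ab; have few := admissible_few_small Ab.
have [e1 e2 _ _] := admissible_B0 Ab.
have gap i : i + 2 < size b ->
    nth 0 b (i + 2) + 6 + (nth 0 b i %% 6 == 0) <= nth 0 b i.
  move=> lt; have /andP[_ /allP pos] := admissible_sorted Ab.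
  have := admissible_nth Ab (pos _ (mem_nth 0 (leq_ltn_trans (leq_addr 2 i) lt))).
  case/and5P=> _ _ _ _ /andP[]; have := pos _ (mem_nth 0 lt); rewrite addn2.
  by move=> pos2 /orP[/eqP b20|//]; rewrite b20 in pos2.
split.
- elim: b Ab {few e1 e2 gap} => // p b IH Apb x x6; rewrite mult_cons.
  case: eqVneq => [E|_]; last exact: IH (admissible_tail Apb) x x6.
  by rewrite -E (mult_top Apb) // E; move: x6; clear; lia.
- by move=> i /gap; apply: leq_trans; apply: leq_addr.
- by move=> i /gap le d6; move: le; rewrite [_ == 0]d6 addn1.
- have e10 : mult b 3 = 0 := e1 0; have e20 : mult b 2 + mult b 4 <= 1 := e2 0.
  by move=> [|[|[|[|j]]]] // _; rewrite unlock /=; clear -few e10 e20; lia.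
by rewrite unlock /=; clear -few; lia.
Qed.

Lemma conds_tail p b : B_cond 5 3 3 (p :: b) -> B0_cond (p :: b) ->
  B_cond 5 3 3 b /\ B0_cond b.
Proof.
have le v : mult b v <= mult (p :: b) v by rewrite mult_cons leq_addl.
move=> [m1 m2 m3 m4 m5] [e1 e2 e3 e4]; split; split.
- by move=> x /m1; apply: leq_trans.
- by move=> i; apply: (m2 i.+1).
- by move=> i; apply: (m3 i.+1).
- move=> j /m4; apply: leq_trans; rewrite leq_add2r.
  by apply: leq_sum.
- by apply: leq_trans m5; rewrite leq_add2r; apply: leq_sum.
- by move=> j; have := le (6 * j + 3); rewrite e1 leqn0 => /eqP.
- by move=> j; apply: leq_trans (e2 j); apply: leq_add.
- by move=> j; apply: leq_trans (e3 j); apply: leq_add.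
- by move=> j j1; apply: leq_trans (e4 j j1); do 3 apply: leq_add => //.
Qed.

Lemma conds_admissible b : sorted geq b -> all (leq 1) b ->
  B_cond 5 3 3 b -> B0_cond b -> admissible b.
Proof.
elim: b => // p b IH pb pos cB c0.
have [cB' c0'] := conds_tail cB c0.
rewrite /= IH ?(path_sorted pb) //; last by case/andP: pos.
rewrite andbT; case: cB c0 => m1 m2 m3 _ _ [e1 e2 e3 e4].
have {IH cB' c0'} p0 : 0 < p by case/andP: pos.
have mp : 0 < mult (p :: b) p by rewrite mult_cons eqxx.
have mn i : 0 < nth 0 b i -> 0 < mult b (nth 0 b i) by apply: mult_pos.
have m0 := mn 0; have m1' := mn 1; have m2' := mn 2.
have b1p : nth 0 b 0 <= p by case: (b) pb => //= x b' /andP[].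
rewrite /fits p0 b1p /=; apply/and5P; split.
- apply/eqP=> p3; have := e1 (p %/ 6).
  rewrite (_ : 6 * _ + 3 = p); last by clear -p3; lia.
  by move=> mp0; rewrite mp0 in mp.
- apply/implyP=> /eqP bE; apply: contraT => p6.
  have /m1 : ~~ (6 %| p) by clear -p6; lia.
  by move: m0; rewrite bE mult_cons eqxx => /(_ p0); clear; lia.
- case: (ltnP 1 (size b)) => [lt|ge]; last by rewrite nth_default.
  have := m2 0; have := m3 0; rewrite /= ltnS => /(_ lt) A3 /(_ lt) A2.
  by move: A2 A3; clear; lia.
- apply/implyP=> /eqP bE; apply/negP=> /eqP p31.
  have b0 : 0 < nth 0 b 0 by clear -bE p31; lia.
  move: (m0 b0) => {m0} m0.
  have [p4|p1] : p = 6 * (p %/ 6) + 4 \/ p = 6 * (p %/ 6 - 1) + 7.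
    by clear -p31 b0 bE; lia.
  + have := e2 (p %/ 6); rewrite -p4 (_ : _ + 2 = nth 0 b 0) ?mult_cons ?eqxx;
      last by clear -p4 bE; lia.
    by move: m0; clear; lia.
  have := e3 (p %/ 6 - 1); rewrite -p1 (_ : _ + 5 = nth 0 b 0) ?mult_cons ?eqxx;
    last by clear -p1 bE; lia.
  by move: m0; clear; lia.
apply/negP=> /and4P[p1 /eqP b1E /eqP b2E /eqP b3E].
have j1 : 0 < (p %/ 6).-1 by clear -p1 b3E; lia.
have pE : p = 6 * (p %/ 6).-1 + 7 by clear -p1 j1; lia.
have := e4 _ j1; rewrite -pE !mult_cons eqxx.
rewrite (_ : _ - 1 = nth 0 b 2); last by clear -pE b3E; lia.
rewrite (_ : _ + 6 = nth 0 b 0); last by clear -pE b1E; lia.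
rewrite (_ : 6 * _ = nth 0 b 1); last by clear -pE b2E; lia.
have := m0; have := m1'; have := m2'.
by clear -b1E b2E b3E j1 pE; lia.
Qed.

(** * Generating functions of finite families of partitions *)

Section GeneratingFunctions.
Import GRing.Theory.
Local Open Scope ring_scope.

(** A multiple of 6 weighs y^2 because it plays the role of two parts; this makes
    y -> y q^6 the right substitution for the factorization. *)
Definition weight (y : {poly int}) (p : nat) : {poly int} :=
  y ^+ (6 %| p).+1 * 'X^p.

(** The family is finite, with generating function G; one enumeration has to serve
    all values of y, since the factorization relates different values. *)
Definition genfun (S : pred (seq nat)) (G : {poly int} -> {poly int}) : Prop :=
  exists2 L : seq (seq nat), uniq L &
    (forall b, (b \in L) = S b) /\
    (forall y, G y = \sum_(b <- L) \prod_(p <- b) weight y p).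

Lemma genfun_ext S S' G G' :
  genfun S G -> S =1 S' -> G =1 G' -> genfun S' G'.
Proof.
move=> [L uL [LS LG]] eS eG; exists L => //.
by split=> [b|y]; [rewrite LS eS | rewrite -eG LG].
Qed.

Lemma genfun_nil : genfun (fun b => b == [::]) (fun=> 1).
Proof.
exists [:: [::]] => //; split=> [b|y]; first by rewrite inE.
by rewrite big_seq1 big_nil.
Qed.

Lemma genfun_cons c (S S1 S2 : pred (seq nat)) G1 G2 :
  genfun S1 G1 -> genfun S2 G2 -> S [::] = S1 [::] ->
  (forall b, S1 (c :: b) = false) ->
  (forall a b, S (a :: b) = S1 (a :: b) || (a == c) && S2 b) ->
  genfun S (fun y => G1 y + weight y c * G2 y).
Proof.
move=> [L1 u1 [L1S G1E]] [L2 u2 [L2S G2E]] S0 S1c Scons.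
have cL b L : (b \in [seq c :: b' | b' <- L]) =
    (if b is a :: b' then (a == c) && (b' \in L) else false).
  case: b => [|a b]; first by apply/mapP; case.
  apply/mapP/andP; first by case=> b' b'L [-> ->]; rewrite eqxx.
  by case=> /eqP -> bL; exists b.
exists (L1 ++ [seq c :: b | b <- L2]).
  rewrite cat_uniq u1 map_inj_uniq ?u2 ?andbT => [|b b' [] //].
  apply/hasPn => b; rewrite cL /= L1S; case: b => // a b /andP[/eqP -> _].
  by rewrite S1c.
split=> [b|y]; first by rewrite mem_cat L1S cL; case: b => [|a b]; rewrite ?orbF // L2S.
rewrite big_cat big_map G1E G2E mulr_sumr; congr (_ + _).
by apply: eq_bigr => b _; rewrite big_cons.
Qed.

(** The exponent of q in the weight of b at y = q^(6r). *)
Definition volume (r : nat) (b : seq nat) : nat :=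
  \sum_(p <- b) (6 * r * (6 %| p).+1 + p).

Lemma genfun_coef S G r n : genfun S G ->
  exists L : seq (seq nat), [/\ uniq L,
    forall b, (b \in L) = S b && (volume r b == n)
    & (G 'X^(6 * r))`_n = (size L)%:Z].
Proof.
case=> L uL [LS ->]; exists [seq b <- L | volume r b == n].
split; first exact: filter_uniq.
  by move=> b; rewrite mem_filter LS andbC.
have W b : \prod_(p <- b) weight 'X^(6 * r) p = 'X^(volume r b).
  rewrite /volume; elim: b => [|p b IH]; first by rewrite !big_nil.
  by rewrite !big_cons IH /weight -exprM -!exprD.
elim: L {uL LS} => [|b L IH]; first by rewrite big_nil coef0.
rewrite big_cons coefD {}IH W coefXn eq_sym /=.
by case: eqP => _ //=; rewrite add0r.
Qed.

Lemma genfun_coef_eq S S' G G' r n : genfun S G -> genfun S' G' ->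
  (forall b, volume r b = n -> S b = S' b) ->
  (G 'X^(6 * r))`_n = (G' 'X^(6 * r))`_n.
Proof.
move=> /(genfun_coef r n)[L [uL LS ->]] /(genfun_coef r n)[L' [uL' LS' ->]] eS.
congr (Posz _); apply/perm_size/uniq_perm => // b.
by rewrite LS LS'; case: eqP => [/eS ->|_]; rewrite ?andbF.
Qed.

Lemma num_partitions_genfun n (P : seq nat -> Prop) S G : genfun S G ->
  (forall b, is_partition n b /\ P b <-> S b /\ sumn b = n) ->
  (num_partitions n P)%:Z = (G 'X^(6 * 0))`_n.
Proof.
move=> /(genfun_coef 0 n)[L [uL LS ->]] PS.
have v0 b : volume 0 b = sumn b.
  by rewrite sumnE; apply: eq_bigr => p _; rewrite muln0 mul0n.
congr (Posz _); apply: num_partitionsE => // b.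
rewrite LS v0 PS; split=> [/andP[-> /eqP]|[-> ->]] //.
by rewrite eqxx.
Qed.

End GeneratingFunctions.

(** * Families defined by bounds on the first two parts *)

Definition capped (m k : nat) (b : seq nat) : bool :=
  [&& admissible b, nth 0 b 0 <= m & nth 0 b 1 <= k].

Lemma capped_diag m b :
  capped m m b = admissible b && (nth 0 b 0 <= m).
Proof.
rewrite /capped; case: (boolP (admissible b)) => //= Ab.
by case: leqP => // /(leq_trans (nth_antitone 0 Ab)) ->.
Qed.

(** Removal of the largest part: when c exceeds m1 and only c lies between m1 and m
    among the possible parts, the members of (capped m k) are those of
    (capped m1 k1) and those obtained from (capped k2 l2) by adding c.  The
    hypotheses express this through arithmetic on at most two parts at a time, so
    that for given bounds each of them is a small problem of linear arithmetic. *)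
Lemma capped_cons c m k m1 k1 k2 l2 :
  [&& 0 < c, c %% 6 != 3, m1 < c, c <= m & k2 <= k] ->
  (forall a, a %% 6 != 3 -> a != c -> a <= m -> a <= m1) ->
  (forall a x, a %% 6 != 3 -> x %% 6 != 3 -> (x == a) ==> (a %% 6 == 0) ->
     x <= a -> a <= m1 -> (x <= k) = (x <= k1)) ->
  (forall x, x %% 6 != 3 -> (x == c) ==> (c %% 6 == 0) ->
     (x + 2 == c) ==> (c %% 3 != 1) -> x <= c -> x <= k -> x <= k2) ->
  (forall y, y <= k2 -> (y == 0) || (y + 6 + (c %% 6 == 0) <= c) -> y <= l2) ->
  (forall x, x <= k2 -> x %% 6 != 3 ->
    [&& x <= c, (x == c) ==> (c %% 6 == 0) & (x + 2 == c) ==> (c %% 3 != 1)]) ->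
  (forall x y, x %% 6 != 3 -> y %% 6 != 3 -> (y == x) ==> (x %% 6 == 0) ->
     (y + 2 == x) ==> (x %% 3 != 1) -> y <= x -> x <= k2 -> y <= l2 ->
     (y == 0) || (y + 6 + (c %% 6 == 0) <= c)) ->
  (forall x y, c %% 6 == 1 -> x <= k2 -> y <= l2 -> ~~ ((x + 1 == c) && (y + 7 == c))) ->
  forall a b, capped m k (a :: b) =
              capped m1 k1 (a :: b) || (a == c) && capped k2 l2 b.
Proof.
move=> /and5P[c0 c3 m1c cm k2k] E1 E2 E3 E4 E5 E6 E7 a b.
rewrite /capped /=; case Ab: (admissible b); last by rewrite !(andbF, andFb).
rewrite !andbT /=; set x := nth 0 b 0; set y := nth 0 b 1; set z := nth 0 b 2.
have /and5P[x3 y3 yx _ /and3P[yx6 _ yx2]] : head_shape x y z := admissible_head Ab.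
case: eqVneq => [->|ne].
  rewrite (leqNgt c m1) m1c cm andbF orFb /=.
  apply/andP/andP => [[/and5P[_ _ xc xc6 /and3P[yc xc2 _]] xk]|[xk yl]].
    have xk2 := E3 x x3 xc6 xc2 xc xk.
    by split=> //; apply: E4 yc; apply: leq_trans yx xk2.
  have /and3P[xc xc6 xc2] := E5 x xk x3; split; last exact: leq_trans xk k2k.
  rewrite /fits c0 c3 xc xc6 xc2 (E6 x y) //=.
  by apply/negP => /and4P[c1 e1 e2 _]; have := E7 x y c1 xk yl; rewrite e1 e2.
rewrite orbF; case: (boolP (fits _ _ _ _)) => //= /and5P[_ a3 xa xa6 _].
case: (leqP a m1) => [am1|m1a] /=; last first.
  by case: (leqP a m) => // /(E1 a a3 ne); rewrite leqNgt m1a.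
by rewrite (leq_trans am1 (ltnW (leq_trans m1c cm))) (E2 a x).
Qed.

(** The next two lemmas describe what may lie below a part 6N+7: either a partition
    with parts at most 6N+4, or 6N+6 followed by parts whose first two are bounded
    by 6N+1 and 6N-2.  The latter bound combines the gap condition with the
    exclusion of the chain 6N-1, 6N, 6N+6, 6N+7. *)
Lemma fits_one_below N a x y z : a != 6 * N + 6 -> head_shape x y z ->
  fits (6 * N + 7) a x y && fits a x y z = fits a x y z && (a <= 6 * N + 4).
Proof.
move=> ne /and5P[x3 _ _ _ _]; rewrite [LHS]andbC.
case: (boolP (fits a x y z)) => //= /and5P[_ a3 xa xa6 /and3P[_ xa2 _]].
apply/idP/idP => [/and5P[_ _ a7 a76 /and3P[_ a72 _]]|a4].
  by clear -ne a3 a7 a76 a72; lia.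
apply/and5P; split; [clear; lia|clear; lia|clear -a4; lia|clear -a4; lia|].
apply/and3P; split; [|clear -a4; lia|clear -a4; lia].
by apply/orP; right; clear -x3 a3 xa xa6 xa2 a4; lia.
Qed.

Lemma fits_multiple_below N x y z : head_shape x y z ->
  fits (6 * N + 7) (6 * N + 6) x y && fits (6 * N + 6) x y z =
  (x <= 6 * N + 1) && (y <= 6 * N - 2).
Proof.
move=> /and5P[x3 _ yx _ /and3P[yx6 _ yx2]].
apply/andP/andP => [[]|[xN yN]].
  move=> /and5P[_ _ _ _ /and3P[x7 _ pat]] /and5P[_ _ _ _ /andP[y6 _]].
  have xN : x <= 6 * N + 1 by clear -x7; lia.
  split=> //; have {y6} yN : y <= 6 * N - 1 by clear -y6; lia.
  case: (eqVneq y (6 * N - 1)) => yE; last by clear -yN yE; lia.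
  case: (posnP N) => N0; first by clear -yE N0; lia.
  have xE : x = 6 * N - 1 \/ x = 6 * N \/ x = 6 * N + 1 by clear -yE xN yx; lia.
  case: xE pat yx6 yx2 => [|[|]] -> pat yx6 yx2.
  - by move: yx6; rewrite yE; clear -N0; lia.
  - by move: pat; rewrite yE; clear -N0; lia.
  - by move: yx2; rewrite yE; clear -N0; lia.
split; apply/and5P; split; try (clear -xN; lia); apply/and3P; split;
  try (clear -xN; lia); clear -yN; lia.
Qed.

(** * The recurrence by blocks and its factorization *)

(** In this section v stands for q^(6N).  The four components are the generating
    functions of (capped (6N-1) (6N-1)), (capped (6N+2) (6N+2)),
    (capped (6N+2) (6N-1)) and (capped (6N+1) (6N-2)), in this order.  In the names
    below the digit is the bound on the first part relative to 6N (cut0 has parts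
    below 6N); cut means that the second part has no further bound, gap that it is
    below 6N (below 6N-1 in gap1), wide that it is at most 6N+2, and under7 is the
    family of the partitions that can lie below the part 6N+7. *)
Section Algebra.
Import GRing.Theory.
Local Open Scope ring_scope.
Variables (R : comNzRingType) (q : R).

Record block := Block { cut0 : R; cut2 : R; gap2 : R; gap1 : R }.

Section Step.
Variables (y v : R) (s : block).

Definition cut4 := cut2 s + y * v * q ^+ 4 * gap1 s.
Definition gap4 := gap2 s + y * v * q ^+ 4 * cut0 s.
Definition gap5 := gap4 + y * v * q ^+ 5 * cut0 s.
Definition cut5 := cut4 + y * v * q ^+ 5 * gap4.
Definition wide5 := cut4 + y * v * q ^+ 5 * gap2 s.
Definition cut6 :=
  cut5 + y ^+ 2 * v * q ^+ 6 * (gap5 + y ^+ 2 * v * q ^+ 6 * cut0 s).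
Definition under7 := cut4 + y ^+ 2 * v * q ^+ 6 * gap1 s.
Definition cut7 := cut6 + y * v * q ^+ 7 * under7.
Definition wide6 := wide5 + y ^+ 2 * v * q ^+ 6 * gap2 s.

Definition next_block := Block cut5
  (cut7 + y * v * q ^+ 8 * (wide6 + y * v * q ^+ 7 * cut2 s))
  (cut5 + y ^+ 2 * v * q ^+ 6 * gap5 + y * v * q ^+ 7 * cut4
    + y * v * q ^+ 8 * wide5)
  (cut5 + y ^+ 2 * v * q ^+ 6 * gap4 + y * v * q ^+ 7 * cut4).

Definition scale (c : R) :=
  Block (c * cut0 s) (c * cut2 s) (c * gap2 s) (c * gap1 s).

End Step.

(** The value of (factor y) times the block at y q^6.  The first component is the one
    aimed at.  The components gap2 and gap1 count partitions as well: those with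
    parts at most 6N+7, respectively 6N+6, and those in which 6N+8 or 6N+12 lies on
    a member of the wide6 family, respectively 6N+7 or 6N+12 on a member of the
    under7 family.  The component cut2 is obtained by solving for it the equation
    that cut5 of this block, taken at y q^6, is cut6 of the next block at y. *)
Definition insert_factor (y v : R) (s : block) : block :=
  let h := cut6 y v s in
  let f := cut7 y v s + (y * v * q ^+ 8 + y ^+ 2 * v * q ^+ 12) * wide6 y v s in
  let g := cut6 y v s + (y * v * q ^+ 7 + y ^+ 2 * v * q ^+ 12) * under7 y v s in
  Block h
    (cut6 y (v * q ^+ 6) (next_block y v s)
      - y * v * q ^+ 10 * g - y * v * q ^+ 11 * (f + y * v * q ^+ 10 * h))
    f g.

Definition factor (y : R) : R :=
  (1 + y * q) * (1 + y * q ^+ 2) * (1 + y * q ^+ 4) * (1 + y * q ^+ 5).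

Fixpoint blocks (y : R) (N : nat) : block :=
  if N is N'.+1 then next_block y (q ^+ (6 * N')) (blocks y N')
  else Block 1 ((1 + y * q) * (1 + y * q ^+ 2)) (1 + y * q + y * q ^+ 2) (1 + y * q).

Lemma block_eq a b c d a' b' c' d' :
  a = a' -> b = b' -> c = c' -> d = d' -> Block a b c d = Block a' b' c' d'.
Proof. by move=> -> -> -> ->. Qed.

Lemma scale_next_block c y v s :
  scale (next_block y v s) c = next_block y v (scale s c).
Proof.
by apply: block_eq;
  rewrite /scale /next_block /cut7 /wide6 /under7 /cut6 /wide5 /cut5 /gap5 /gap4
          /cut4 /=; ring.
Qed.

(** The intertwining relation.  Both sides are polynomials in q, y, v and the four
    components of s, and they agree identically. *)
Lemma insert_factor_next y v s :
  next_block (y * q ^+ 6) v (insert_factor y v s) =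
  insert_factor y (v * q ^+ 6) (next_block y v s).
Proof.
by apply: block_eq;
  rewrite /insert_factor /next_block /cut7 /wide6 /under7 /cut6 /wide5 /cut5
          /gap5 /gap4 /cut4 /=; ring.
Qed.

Lemma blocks_factor y N :
  scale (blocks (y * q ^+ 6) N) (factor y) =
  insert_factor y (q ^+ (6 * N)) (blocks y N).
Proof.
elim: N => [|N IH].
  by apply: block_eq;
    rewrite /insert_factor /scale /factor /next_block /cut7 /wide6 /under7 /cut6
            /wide5 /cut5 /gap5 /gap4 /cut4 /=; ring.
rewrite /= scale_next_block IH insert_factor_next; congr insert_factor.
by rewrite -exprD mulnS addnC.
Qed.

(** The finite form of the theorem: one factor of the product is what distinguishes
    the partitions with parts at most 6N+6 at y from those with parts below 6N at
    y q^6. *)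
Lemma cut6_factor y N :
  cut6 y (q ^+ (6 * N)) (blocks y N) = factor y * cut0 (blocks (y * q ^+ 6) N).
Proof. by have := congr1 cut0 (blocks_factor y N). Qed.

End Algebra.

(** * Combinatorial meaning of the recurrence *)
Section BlockGeneratingFunctions.
Import GRing.Theory.
Local Open Scope ring_scope.

Notation q := ('X : {poly int}).

Lemma capped_genfun c m k m1 k1 k2 l2 G1 G2 :
  (m1 < c)%N ->
  genfun (capped m1 k1) G1 -> genfun (capped k2 l2) G2 ->
  (forall a b, capped m k (a :: b) =
     capped m1 k1 (a :: b) || (a == c) && capped k2 l2 b) ->
  genfun (capped m k) (fun y => G1 y + weight y c * G2 y).
Proof.
move=> m1c H1 H2; apply: genfun_cons H1 H2 _ _ => // b.
by rewrite /capped /= (leqNgt c) m1c andbF.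
Qed.

Lemma weightE y N i :
  ~~ (6 %| i)%N -> weight y (6 * N + i) = y * q ^+ (6 * N) * q ^+ i.
Proof.
move=> i6; rewrite /weight dvdn_addr ?dvdn_mulr // (negbTE i6).
by rewrite exprD mulrA expr1.
Qed.

Lemma weight6E y N : weight y (6 * N + 6) = y ^+ 2 * q ^+ (6 * N) * q ^+ 6.
Proof. by rewrite /weight dvdn_addr ?dvdn_mulr // exprD mulrA. Qed.

Section Step.
Variables (N : nat) (s : {poly int} -> block {poly int}).
Let v := q ^+ (6 * N).
Hypothesis H0 : genfun (capped (6 * N - 1) (6 * N - 1)) (fun y => cut0 (s y)).
Hypothesis H2 : genfun (capped (6 * N + 2) (6 * N + 2)) (fun y => cut2 (s y)).
Hypothesis F2 : genfun (capped (6 * N + 2) (6 * N - 1)) (fun y => gap2 (s y)).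
Hypothesis F1 : genfun (capped (6 * N + 1) (6 * N - 2)) (fun y => gap1 (s y)).

Ltac add_part H H' c :=
  apply: (genfun_ext (capped_genfun (c := c) _ H H' _) (frefl _));
  [ clear; lia | apply: capped_cons; clear; lia
  | by move=> y /=; rewrite ?weight6E ?weightE ].

Lemma genfun_cut4 : genfun (capped (6 * N + 4) (6 * N + 4)) (fun y => cut4 q y v (s y)).
Proof. add_part H2 F1 (6 * N + 4)%N. Qed.

Lemma genfun_gap4 : genfun (capped (6 * N + 4) (6 * N - 1)) (fun y => gap4 q y v (s y)).
Proof. add_part F2 H0 (6 * N + 4)%N. Qed.

Lemma genfun_gap5 : genfun (capped (6 * N + 5) (6 * N - 1)) (fun y => gap5 q y v (s y)).
Proof. add_part genfun_gap4 H0 (6 * N + 5)%N. Qed.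

Lemma genfun_cut5 : genfun (capped (6 * N + 5) (6 * N + 5)) (fun y => cut5 q y v (s y)).
Proof. add_part genfun_cut4 genfun_gap4 (6 * N + 5)%N. Qed.

Lemma genfun_wide5 : genfun (capped (6 * N + 5) (6 * N + 2)) (fun y => wide5 q y v (s y)).
Proof. add_part genfun_cut4 F2 (6 * N + 5)%N. Qed.

Lemma genfun_cut6 : genfun (capped (6 * N + 6) (6 * N + 6)) (fun y => cut6 q y v (s y)).
Proof.
have H : genfun (capped (6 * N + 6) (6 * N - 1))
  (fun y => gap5 q y v (s y) + y ^+ 2 * v * q ^+ 6 * cut0 (s y)).
  add_part genfun_gap5 H0 (6 * N + 6)%N.
add_part genfun_cut5 H (6 * N + 6)%N.
Qed.

Lemma genfun_next_gap1 : genfun (capped (6 * N + 7) (6 * N + 4))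
  (fun y => gap1 (next_block q y v (s y))).
Proof.
have H : genfun (capped (6 * N + 6) (6 * N + 4))
  (fun y => cut5 q y v (s y) + y ^+ 2 * v * q ^+ 6 * gap4 q y v (s y)).
  add_part genfun_cut5 genfun_gap4 (6 * N + 6)%N.
add_part H genfun_cut4 (6 * N + 7)%N.
Qed.

Lemma genfun_next_gap2 : genfun (capped (6 * N + 8) (6 * N + 5))
  (fun y => gap2 (next_block q y v (s y))).
Proof.
have H6 : genfun (capped (6 * N + 6) (6 * N + 5))
  (fun y => cut5 q y v (s y) + y ^+ 2 * v * q ^+ 6 * gap5 q y v (s y)).
  add_part genfun_cut5 genfun_gap5 (6 * N + 6)%N.
have H7 : genfun (capped (6 * N + 7) (6 * N + 5))
  (fun y => cut5 q y v (s y) + y ^+ 2 * v * q ^+ 6 * gap5 q y v (s y)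
    + y * v * q ^+ 7 * cut4 q y v (s y)).
  add_part H6 genfun_cut4 (6 * N + 7)%N.
add_part H7 genfun_wide5 (6 * N + 8)%N.
Qed.

(** Here the third part matters too, so the family is not of the form (capped m k). *)
Lemma genfun_under7 : genfun (fun b => admissible (6 * N + 7 :: b)%N)
  (fun y => under7 q y v (s y)).
Proof.
have c4 a b : capped (6 * N + 4) (6 * N + 4) (a :: b) =
   admissible (a :: b) && (a <= 6 * N + 4)%N.
  rewrite /capped /=; case: (boolP (fits _ _ _ _)) => //= /and5P[_ _ ba _ _].
  by case: (leqP a) => [/(leq_trans ba) ->|_]; rewrite ?andbF ?andbT.
apply: (genfun_ext (genfun_cons (c := 6 * N + 6) genfun_cut4 F1
  (S := fun b => admissible (6 * N + 7 :: b)%N) _ _ _) (frefl _)).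
- by rewrite /capped /= /fits; clear; lia.
- by move=> b; rewrite c4 leqNgt ltn_add2l andbF.
- move=> a b; rewrite c4 /capped /=.
  case Ab: (admissible b); last by rewrite !(andbF, andFb).
  have sh := admissible_head Ab; rewrite !andbT /=.
  case: (eqVneq a (6 * N + 6)%N) => [->|ne]; last by rewrite fits_one_below // orbF.
  by rewrite fits_multiple_below // leq_add2l andbF.
- by move=> y /=; rewrite weight6E.
Qed.

Lemma genfun_cut7 : genfun (capped (6 * N + 7) (6 * N + 7))
  (fun y => cut7 q y v (s y)).
Proof.
apply: (genfun_ext (genfun_cons (c := 6 * N + 7) genfun_cut6 genfun_under7
  (S := capped (6 * N + 7) (6 * N + 7)) _ _ _) (frefl _)).
- by [].
- by move=> b; rewrite /capped /= (leqNgt (6 * N + 7)) ltn_add2l andbF.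
- move=> a b; rewrite /capped /=.
  case: (boolP (fits a _ _ _)) => [f|nf] /=; last first.
    by case: eqVneq nf => // -> /negbTE ->.
  have /and5P[_ _ ba _ _] := f.
  case: (eqVneq a (6 * N + 7)%N) f ba => [->|ne] f ba /=.
    by rewrite f ba leqnn (leqNgt (_ + 7)) ltn_add2l !andbF !andbT.
  rewrite orbF; congr (_ && _); have [a6|a6] := leqP a (6 * N + 6).
    by rewrite !(leq_trans ba, leq_trans a6) ?leq_add2l.
  by clear -ne a6; lia.
- by move=> y /=; rewrite weightE.
Qed.

Lemma genfun_next_cut2 : genfun (capped (6 * N + 8) (6 * N + 8))
  (fun y => cut2 (next_block q y v (s y))).
Proof.
have H6 : genfun (capped (6 * N + 6) (6 * N + 2)) (fun y => wide6 q y v (s y)).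
  add_part genfun_wide5 F2 (6 * N + 6)%N.
have H7 : genfun (capped (6 * N + 7) (6 * N + 2))
  (fun y => wide6 q y v (s y) + y * v * q ^+ 7 * cut2 (s y)).
  add_part H6 H2 (6 * N + 7)%N.
add_part genfun_cut7 H7 (6 * N + 8)%N.
Qed.

End Step.

Lemma genfun_capped0 k : genfun (capped 0 k) (fun=> 1).
Proof.
apply: genfun_ext genfun_nil _ (frefl _) => -[|a b] //.
by case: a => [|a]; rewrite /capped /= ?andbF.
Qed.

(** For N = 0 the truncated bounds 6N-1 and 6N-2 are 0, which leaves the second part,
    or the whole partition, empty, as it should be. *)
Lemma genfun_blocks N :
  [/\ genfun (capped (6 * N - 1) (6 * N - 1)) (fun y => cut0 (blocks q y N)),
      genfun (capped (6 * N + 2) (6 * N + 2)) (fun y => cut2 (blocks q y N)),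
      genfun (capped (6 * N + 2) (6 * N - 1)) (fun y => gap2 (blocks q y N))
    & genfun (capped (6 * N + 1) (6 * N - 2)) (fun y => gap1 (blocks q y N))].
Proof.
elim: N => [|N [H0 H2 F2 F1]]; last first.
  have E i j : (6 * N.+1 + i = 6 * N + (6 + i))%N /\
     (0 < j <= 6 -> 6 * N.+1 - j = 6 * N + (6 - j))%N by clear; lia.
  rewrite !(E _ 0%N).1 !(E 0%N _).2 //; split.
  - exact: genfun_cut5.
  - exact: genfun_next_cut2.
  - exact: genfun_next_gap2.
  - exact: genfun_next_gap1.
have part c m k m1 k1 k2 l2 G1 G2 : ~~ (6 %| c)%N -> (m1 < c)%N ->
  genfun (capped m1 k1) G1 -> genfun (capped k2 l2) G2 ->
  (forall a b, capped m k (a :: b) =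
     capped m1 k1 (a :: b) || (a == c) && capped k2 l2 b) ->
  genfun (capped m k) (fun y => G1 y + y * q ^+ c * G2 y).
  move=> c6 m1c H1 H2 E; apply: genfun_ext (capped_genfun m1c H1 H2 E) (frefl _) _.
  by move=> y; rewrite /= /weight (negbTE c6).
have one := genfun_capped0.
have g1 : genfun (capped 1 0) (fun y => 1 + y * q * 1).
  apply: (part 1%N _ _ _ _ _ _ _ _ _ _ (one 0%N) (one 0%N)) => //.
  by apply: capped_cons; lia.
have c1 : genfun (capped 1 1) (fun y => 1 + y * q * 1).
  apply: (part 1%N _ _ _ _ _ _ _ _ _ _ (one 0%N) (one 0%N)) => //.
  by apply: capped_cons; lia.
have g2 : genfun (capped 2 0) (fun y => 1 + y * q * 1 + y * q ^+ 2 * 1).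
  apply: (part 2%N _ _ _ _ _ _ _ _ _ _ g1 (one 0%N)) => //.
  by apply: capped_cons; lia.
have c2 : genfun (capped 2 2) (fun y => 1 + y * q * 1 + y * q ^+ 2 * (1 + y * q * 1)).
  apply: (part 2%N _ _ _ _ _ _ _ _ _ _ c1 g1) => //.
  by apply: capped_cons; lia.
split=> /=; [apply: one | apply: genfun_ext c2 _ _ | apply: genfun_ext g2 _ _
  | apply: genfun_ext g1 _ _] => // y /=; rewrite !mulr1 //; ring.
Qed.

End BlockGeneratingFunctions.

(** * Coefficients of the product *)

Section Convergence.
Import GRing.Theory.
Local Open Scope ring_scope.

Notation q := ('X : {poly int}).

(** Passing from 6N-1 to 6N+6 does not change the n-th coefficient, because the parts
    in between weigh more than q^n at y = q^(6r); then the finite identity splits off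
    one factor and replaces r by r+1.  The recursion stops when n < 6r, where only
    the empty partition contributes. *)
Lemma coef_blocks K r N n : (n < 6 * (r + K))%N -> (n <= 6 * N - 1 + 6 * r)%N ->
  (cut0 (blocks q (q ^+ (6 * r)) N))`_n =
  (\prod_(i < K) factor q (q ^+ (6 * (r + i))))`_n.
Proof.
elim: K r n => [|K IH] r n nK nN.
  have [H0 _ _ _] := genfun_blocks N.
  rewrite big_ord0 (genfun_coef_eq (r := r) H0 genfun_nil) // => -[|p b] //.
  by rewrite /volume big_cons; case: (6 %| p)%N; move: nK; clear; lia.
have [H0 H2 F2 F1] := genfun_blocks N.
have H6 := genfun_cut6 H0 H2 F2 F1.
transitivity ((cut6 q (q ^+ (6 * r)) (q ^+ (6 * N)) (blocks q (q ^+ (6 * r)) N))`_n).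
  apply: (genfun_coef_eq (r := r) H0 H6) => b; rewrite !capped_diag.
  case: b => // p b; rewrite /volume big_cons => vE; congr (_ && _).
  by move: vE nN => /=; case: (6 %| p)%N; clear; lia.
rewrite cut6_factor -exprD -mulnSr big_ord_recl addn0 !coefM.
apply: eq_bigr => i _; congr (_ * _).
rewrite IH.
- by congr (polyseq _)`__; apply: eq_bigr => j _; rewrite lift0 addSnnS.
- by move: nK; clear; lia.
- by move: nN; clear; lia.
Qed.

End Convergence.

(** * Partitions into distinct parts prime to 3 *)

Section DistinctParts.
Import GRing.Theory.
Local Open Scope ring_scope.

Notation q := ('X : {poly int}).

Definition distinct_nonmultiples (m : nat) (b : seq nat) : bool :=
  path gtn m.+1 b && all (fun p => ~~ (3 %| p))%N b.

Lemma genfun_distinct_next m c G : c = m.+1 -> ~~ (3 %| c)%N ->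
  genfun (distinct_nonmultiples m) G ->
  genfun (distinct_nonmultiples c) (fun y => (1 + weight y c) * G y).
Proof.
move=> -> m3 H; apply: (genfun_ext (genfun_cons (c := m.+1) H H
  (S := distinct_nonmultiples m.+1) _ _ _) (frefl _)) => //.
- by move=> b; rewrite /distinct_nonmultiples /= ltnn.
- move=> a b; rewrite /distinct_nonmultiples /= [(a < m.+2)%N]ltnS leq_eqVlt.
  by case: eqVneq => [->|_] /=; rewrite ?ltnn ?m3 ?orbF.
- by move=> y; rewrite mulrDl mul1r.
Qed.

Lemma genfun_distinct_skip m c G : c = m.+1 -> (3 %| c)%N ->
  genfun (distinct_nonmultiples m) G -> genfun (distinct_nonmultiples c) G.
Proof.
move=> -> m3 H; apply: (genfun_ext H _ (frefl _)) => -[|a b] //.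
rewrite /distinct_nonmultiples /= [(a < m.+2)%N]ltnS [in RHS]leq_eqVlt.
by case: eqVneq => [->|_] //=; rewrite ltnn m3 andbF /= andbF.
Qed.

Lemma genfun_distinct K : genfun (distinct_nonmultiples (6 * K))
  (fun y => \prod_(i < K) factor q (y * q ^+ (6 * i))).
Proof.
elim: K => [|K IH].
  apply: (genfun_ext genfun_nil) => [[|[|a] b]|y] //.
    by rewrite /distinct_nonmultiples /= andbF.
  by rewrite big_ord0.
have next i j G : (j = i.+1)%N -> ~~ (3 %| j)%N -> ~~ (6 %| j)%N ->
    genfun (distinct_nonmultiples (6 * K + i)) G ->
    genfun (distinct_nonmultiples (6 * K + j))
      (fun y => (1 + y * q ^+ (6 * K) * q ^+ j) * G y).
  move=> jE j3 j6 H; have c3 : ~~ (3 %| 6 * K + j)%N by clear -j3; lia.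
  apply: genfun_ext (genfun_distinct_next _ c3 H) (frefl _) _.
    by rewrite jE addnS.
  by move=> y; rewrite /= weightE.
have skip i j G : (j = i.+1)%N -> (3 %| j)%N ->
    genfun (distinct_nonmultiples (6 * K + i)) G ->
    genfun (distinct_nonmultiples (6 * K + j)) G.
  move=> jE j3; apply: genfun_distinct_skip; first by rewrite jE addnS.
  by clear -j3; lia.
rewrite -[(6 * K)%N]addn0 in IH.
have {}IH := next 0%N 1%N _ erefl isT isT IH.
have {}IH := next 1%N 2 _ erefl isT isT IH.
have {}IH := skip 2 3 _ erefl isT IH.
have {}IH := next 3 4 _ erefl isT isT IH.
have {}IH := next 4 5 _ erefl isT isT IH.
have {next skip} := skip 5 6 _ erefl isT IH.
rewrite addnC -mulnS => H; apply: (genfun_ext H (frefl _)) => y.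
rewrite big_ord_recr /= /factor expr1.
move: (\prod_(i < K) _) (y * q ^+ (6 * K)) => P z.
by ring.
Qed.

End DistinctParts.

(** * The theorem *)

(** For k = a = 3 and lambda = 5 the integer modulus and residues of A_cond evaluate
    to 12 and 0, 3, -3; Negz 2 is -3. *)
Lemma A_cond_part x :
  [&& (Posz x != Posz 0 %[mod Posz 12])%Z, (Posz x != Posz 3 %[mod Posz 12])%Z
    & (Posz x != Negz 2 %[mod Posz 12])%Z] && (x != 6 %[mod 12]) = ~~ (3 %| x).
Proof.
have z0 : modz (Posz 0) (Posz 12) = Posz 0 by [].
have z3 : modz (Posz 3) (Posz 12) = Posz 3 by [].
have z9 : modz (Negz 2) (Posz 12) = Posz 9 by [].
rewrite z0 z3 z9 modz_nat !eqz_nat.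
by lia.
Qed.

Lemma A_cond_distinct n b :
  is_partition n b /\ A_cond 5 3 3 b <->
  distinct_nonmultiples (6 * n) b /\ sumn b = n.
Proof.
rewrite /is_partition /distinct_nonmultiples; split.
  case=> /and3P[sb pos /eqP <-] [m1 m6 m12]; split=> //.
  have n3 : all (fun p => ~~ (3 %| p)) b.
    apply/allP=> x xb; rewrite -A_cond_part (m6 x xb) andbT.
    by have [h1 h2 h3] := m12 x xb; apply/and3P.
  rewrite n3 andbT; have ub : uniq b.
    apply: count_mem_uniq => x; have := m1 x; case: (boolP (x \in b)) => xb.
      rewrite (allP n3 x xb) => /(_ isT); rewrite /mult.
      have : 0 < count_mem x b by rewrite -has_count has_pred1.
      by case: count => [|[]].
    by move=> _; apply/count_memPn.
  have : sorted gtn b by rewrite gtn_sorted_uniq_geq ub.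
  by case: b {sb pos m1 m6 m12 n3 ub} => //= p b ->; rewrite andbT; clear; lia.
case=> /andP[sb n3] <-; have {}sb := path_sorted sb.
have /andP[ub gb] : uniq b && sorted geq b by rewrite -gtn_sorted_uniq_geq.
split.
  rewrite gb eqxx andbT /=; apply/allP=> x xb; have := allP n3 x xb.
  by case: x {xb}.
split.
- by move=> x _; rewrite /mult count_uniq_mem // leq_b1.
- by move=> x /(allP n3); rewrite -A_cond_part => /andP[].
by move=> x /(allP n3); rewrite -A_cond_part => /andP[/and3P[]].
Qed.

Lemma B_cond_admissible n b :
  is_partition n b /\ (B_cond 5 3 3 b /\ B0_cond b) <->
  capped (6 * n.+1 - 1) (6 * n.+1 - 1) b /\ sumn b = n.
Proof.
rewrite capped_diag /is_partition; split.
  case=> /and3P[sb pos /eqP <-] [cB c0]; split=> //.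
  rewrite conds_admissible //=; case: b {sb pos cB c0} => //= p b; clear; lia.
case=> /andP[Ab _] <-; have /andP[-> ->] := admissible_sorted Ab.
by rewrite eqxx; split=> //; split; [apply: admissible_B | apply: admissible_B0].
Qed.

Theorem theorem3 : forall n : nat, 0 < n -> A 5 3 3 n = B0_533 n.
Proof.
move=> n n_gt0; have [H0 _ _ _] := genfun_blocks n.+1.
suff: Posz (A 5 3 3 n) = Posz (B0_533 n) by case.
rewrite /B0_533 (num_partitions_genfun H0 (B_cond_admissible n)).
rewrite /A (num_partitions_genfun (genfun_distinct n) (A_cond_distinct n)).
rewrite (coef_blocks (K := n)); [|lia|lia].
congr ((polyseq _)`_ _)%R; apply: eq_bigr => i _.
by rewrite muln0 GRing.expr0 GRing.mul1r.
Qed.
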